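(* Let $\Omega\subseteq\mathbb{R}^d$, $f:\Omega\to\mathbb{R}$, let $J\ge 1$, let $X_1\subset\cdots\subset X_J$ be nested finite nonempty sets of distinct points of $\Omega$ with $n_j=\operatorname{card}X_j$, and let $\Phi_1,\ldots,\Phi_J$ be symmetric, continuous, positive definite, translation invariant kernels. Let $\mathcal{P}^j$ be the stage-$j$ multi-step interpolators and $\tilde{\mathcal{P}}^j$ their computed versions, as defined in the context. Suppose that there are $\delta_1,\ldots,\delta_J,\delta,D>0$ and $r$ such that for every $j=1,\ldots,J$, $$\|A_{X_j,\Phi_j}-\tilde A_{X_j,\Phi_j}\|_2\le\delta_j\|A_{X_j,\Phi_j}\|_2,\qquad \big\|f|_{X_j}-\tilde f|_{X_j}\big\|_2\le\delta\big\|f|_{X_j}\big\|_2,$$ $$\kappa(A_{X_j,\Phi_j})\le r/\delta_j<1/\delta_j,\qquad \sup_{x,y\in\Omega}|\Phi_j(x-y)-\tilde\Phi_j(x-y)|<D\delta,$$ and $$\delta_j\Big\|\Big(f-\sum_{k=1}^{j-1}\mathcal{P}^k\Big)\Big|_{X_j}\Big/\sqrt{n_j}\Big\|_2\le\delta\,\big\|f|_{X_j}/\sqrt{n_j}\big\|_2 .$$ Then for every $x\in\Omega$, $$\Big|\sum_{j=1}^J\mathcal{P}^j(x)-\sum_{j=1}^J\tilde{\mathcal{P}}^j(x)\Big|\le\delta\,\big\|f|_{X_J}/\sqrt{n_J}\big\|_2\Bigg[\sum_{M=1}^J C^M\sum_{i\in\mathcal{S}_J(M)}\ \prod_{k=1}^M\rho(X_{i_k},X_{i_{k+1}})\,g(X_{i_k},\Phi_{i_k})\Bigg],$$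 where $C=2/(1-r)$, $\mathcal{S}_J(M)=\{i\in\mathbb{N}^{M+1}: 1\le i_1<\cdots<i_M\le i_{M+1}=J\}$, $$\rho(X,Y)=\frac{\|f|_X/\sqrt{\operatorname{card}X}\|_2}{\|f|_Y/\sqrt{\operatorname{card}Y}\|_2},\qquad g(X,\Phi)=\frac{\operatorname{card}X}{\lambda_{\min}(A_{X,\Phi})}\big(\kappa(A_{X,\Phi})\Phi(0)+D\big).$$
   Context: A translation invariant kernel is written $\Phi(x-y)$. It is positive definite on the domain considered if $\sum_{i,l}\alpha_i\alpha_l\Phi(x_i-x_l)>0$ for all finite sets of distinct points $x_1,\dots,x_n$ and all nonzero $\alpha\in\mathbb{R}^n$. For a finite set $X=\{x_1,\dots,x_n\}$ of distinct points, $A_{X,\Phi}=\{\Phi(x_u-x_v)\}_{u,v}$ and $f|_X=(f(x_1),\dots,f(x_n))'$. $\|\cdot\|_2$ is the Euclidean norm for vectors and the induced spectral norm $\|A\|_2=\sqrt{\lambda_{\max}(A'A)}$ for matrices; $\kappa(A)=\|A\|_2\|A^{-1}\|_2$; $\lambda_{\min},\lambda_{\max}$ are smallest and largest eigenvalues. Multi-step interpolator: $\mathcal{P}^0\equiv0$, and for $j=1,\dots,J$, $\mathcal{P}^j(x)=\sum_{u=1}^{n_j}\alpha^j_u\Phi_j(x-x_u)$ (sum over the points $x_u$ of $X_j$), where $\alpha^j$ solves $A_{X_j,\Phi_j}\alpha^j=(f-\sum_{k=0}^{j-1}\mathcal{P}^k)|_{X_j}$. Computed (tilde) quantities are perturbations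 of the exact ones: $\tilde f$ is a real-valued function on $X_J$, $\tilde A_{X_j,\Phi_j}$ a real $n_j\times n_j$ matrix, $\tilde\Phi_j$ a real-valued function, restricted only by the stated hypotheses. With $\tilde{\mathcal{P}}^0\equiv0$, $\tilde{\mathcal{P}}^j(x)=\sum_{u=1}^{n_j}\tilde\alpha^j_u\tilde\Phi_j(x-x_u)$, where $\tilde\alpha^j$ satisfies $\tilde A_{X_j,\Phi_j}\tilde\alpha^j=(\tilde f-\sum_{k=0}^{j-1}\tilde{\mathcal{P}}^k)|_{X_j}$. The denominators of all ratios $\rho(\cdot,\cdot)$ appearing are understood to be nonzero.
   Formalization: The formal theorem additionally assumes δ ≤ 1; without it the claim fails, e.g. Ω=X_1={0}, J=1, Φ(0)=1, f=1, Ã=A, δ_1=r=1/2, D=1, δ=10, f̃=11, Φ̃(0)=10 gives 109 on the left and 80 on the right. *)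

(* Defs.v *)
From HB Require Import structures.
From mathcomp Require Import all_boot all_order all_algebra finmap.
From mathcomp Require Import boolp classical_sets functions reals ereal.
From mathcomp Require Import topology normedtype.

Set Implicit Arguments.
Unset Strict Implicit.
Unset Printing Implicit Defensive.

Import Order.TTheory GRing.Theory Num.Theory.
Import numFieldNormedType.Exports.

Local Open Scope classical_set_scope.
Local Open Scope ring_scope.

Section Norms.
Context {R : realType}.

(* The library norm on matrices is the sup norm. *)
Definition l2norm n (v : 'cV[R]_n) : R := Num.sqrt (\sum_(u < n) v u 0 ^+ 2).

(* These are only applied to real symmetric matrices of positive size, whose
   spectrum is a finite nonempty set of reals, so that sup and inf are attained. *)
Definition lambda_max n (A : 'M[R]_n) : R := sup [set l | eigenvalue A l].
Definition lambda_min n (A : 'M[R]_n) : R := inf [set l | eigenvalue A l].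

Definition specnorm n (A : 'M[R]_n) : R := Num.sqrt (lambda_max (A^T *m A)).

Definition kappa n (A : 'M[R]_n) : R := specnorm A * specnorm (invmx A).

End Norms.

Section Kernels.
Context {R : realType} {d : nat}.
Implicit Types (Omega : set 'rV[R]_d) (Phi f : 'rV[R]_d -> R)
  (X Y : {fset 'rV[R]_d}).

(* A translation invariant kernel on Omega is (x, y) |-> Phi (x - y); only the
   values of Phi on differences of points of Omega are constrained. *)

Definition symmetric_kernel Omega Phi : Prop :=
  forall x y, Omega x -> Omega y -> Phi (x - y) = Phi (y - x).

Definition continuous_kernel Omega Phi : Prop :=
  {within Omega `*` Omega,
    continuous (fun p : 'rV[R]_d * 'rV[R]_d => Phi (p.1 - p.2))}.

Definition positive_definite_kernel Omega Phi : Prop :=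
  forall (n : nat) (x : 'I_n -> 'rV[R]_d) (a : 'cV[R]_n),
    injective x -> (forall i, Omega (x i)) -> a != 0 ->
    0 < \sum_(i < n) \sum_(l < n) a i 0 * a l 0 * Phi (x i - x l).

Definition point X (u : 'I_#|` X|) : 'rV[R]_d := nth 0 (enum_fset X) u.

Definition restr f X : 'cV[R]_(#|` X|) := \col_u f (point u).

Definition kernel_mx Phi X : 'M[R]_(#|` X|) :=
  \matrix_(u, v) Phi (point u - point v).

Definition kernel_sum Phi X (a : 'cV[R]_(#|` X|)) (x : 'rV[R]_d) : R :=
  \sum_(u < #|` X|) a u 0 * Phi (x - point u).

(* Stages are numbered from 1; the values at index 0 of the families Phi, X and
   alpha are irrelevant. *)
Definition stage (Phi : nat -> 'rV[R]_d -> R) (X : nat -> {fset 'rV[R]_d})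
    (alpha : forall j, 'cV[R]_(#|` X j|)) (j : nat) (x : 'rV[R]_d) : R :=
  if j is 0%N then 0 else kernel_sum (Phi j) (alpha j) x.

Definition residual f (P : nat -> 'rV[R]_d -> R) (j : nat) (x : 'rV[R]_d) : R :=
  f x - \sum_(0 <= k < j) P k x.

(* The coefficient equations, for an arbitrary family of matrices, so that they
   serve for both the exact and the computed interpolators. *)
Definition solves_stages (J : nat) f (Phi : nat -> 'rV[R]_d -> R)
    (X : nat -> {fset 'rV[R]_d}) (A : forall j, 'M[R]_(#|` X j|))
    (alpha : forall j, 'cV[R]_(#|` X j|)) : Prop :=
  forall j, (1 <= j <= J)%N ->
    A j *m alpha j = restr (residual f (stage Phi alpha) j) (X j).

Definition scaled_norm f X : R :=
  l2norm ((Num.sqrt (#|` X|)%:R)^-1 *: restr f X).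

Definition rho f X Y : R := scaled_norm f X / scaled_norm f Y.

Definition gfactor (D : R) X Phi : R :=
  (#|` X|)%:R / lambda_min (kernel_mx Phi X) *
  (kappa (kernel_mx Phi X) * Phi 0 + D).

End Kernels.

(* The component i_k of an index i in S_J(M), 1 <= k <= M + 1, is the value of
   the finite function at the ordinal k - 1. *)
Definition index_set (J M : nat) : {set {ffun 'I_M.+1 -> 'I_J.+1}} :=
  [set i : {ffun 'I_M.+1 -> 'I_J.+1} |
    [&& [forall k, (1 <= i k)%N],
        [forall k : 'I_M.+1, forall l : 'I_M.+1,
           (k < l < M)%N ==> (i k < i l)%N],
        [forall k, (i k <= i ord_max)%N]
      & (i ord_max == J :> nat)]].

(* For k < M (numbered from 0), the positions of i_(k+1) and of i_(k+2). *)
Definition pos (M : nat) (k : 'I_M) : 'I_M.+1 := widen_ord (leqnSn M) k.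
Definition pos_succ (M : nat) (k : 'I_M) : 'I_M.+1 := lift ord0 k.

(* Main.v *)
Require Import Defs.
From HB Require Import structures.
From mathcomp Require Import all_boot all_order all_algebra finmap.
From mathcomp Require Import boolp classical_sets functions reals ereal.
From mathcomp Require Import topology normedtype.
From mathcomp Require Import ring lra.

Set Implicit Arguments.
Unset Strict Implicit.
Unset Printing Implicit Defensive.

Import Order.TTheory GRing.Theory Num.Theory.
Import numFieldNormedType.Exports.

Local Open Scope classical_set_scope.
Local Open Scope ring_scope.

(* Write F_j for the scaled norm of f on X_j and c_j = C g(X_j, Phi_j). Standard
   perturbation theory for the coefficient system at stage j shows: if T_k (resp.
   delta T_k) bounds the k-th stage P^k (resp. its error) on Omega for all k < j,
   then T_j = c_j (F_j + sum_(k < j) T_k) (resp. delta T_j) does so for stage j. The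
   bound on the interpolants themselves controls the right-hand side of the system,
   which multiplies the kernel error D delta; here delta <= 1 is used. Unfolding the
   recursion expresses T_1 + ... + T_J as the sum over chains i_1 < ... < i_M <= J of
   F_(i_1) c_(i_1) ... c_(i_M), and the ratios rho telescope to F_(i_1) / F_J.
   The spectral facts needed all follow from: the infimum m of the Rayleigh quotient
   of a symmetric S is an eigenvalue, since otherwise S - m is invertible and
   semidefinite, hence coercive. *)

(** * Euclidean norm and spectral bounds *)

Section DotProduct.
Context {R : realType} {n : nat}.
Implicit Types (u v w : 'cV[R]_n) (A S : 'M[R]_n).

Definition dotv u v : R := \sum_i u i 0 * v i 0.

Lemma dotvC u v : dotv u v = dotv v u.
Proof. by apply: eq_bigr => i _; rewrite mulrC. Qed.

Lemma dotvDl u v w : dotv (u + v) w = dotv u w + dotv v w.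
Proof. by rewrite -big_split; apply: eq_bigr => i _; rewrite mxE mulrDl. Qed.

Lemma dotvZl a u v : dotv (a *: u) v = a * dotv u v.
Proof. by rewrite big_distrr; apply: eq_bigr => i _; rewrite mxE -mulrA. Qed.

Lemma dotvDr u v w : dotv w (u + v) = dotv w u + dotv w v.
Proof. by rewrite !(dotvC w) dotvDl. Qed.

Lemma dotvZr a u v : dotv v (a *: u) = a * dotv v u.
Proof. by rewrite !(dotvC v) dotvZl. Qed.

Lemma dotvNr u v : dotv u (- v) = - dotv u v.
Proof. by rewrite -scaleN1r dotvZr mulN1r. Qed.

Lemma dotvNl u v : dotv (- u) v = - dotv u v.
Proof. by rewrite dotvC dotvNr dotvC. Qed.

Lemma dotv_tr A u v : dotv (A *m u) v = dotv u (A^T *m v).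
Proof.
transitivity (\sum_i \sum_j A i j * u j 0 * v i 0).
  by apply: eq_bigr => i _; rewrite mxE big_distrl.
rewrite exchange_big; apply: eq_bigr => j _ /=.
by rewrite mxE big_distrr; apply: eq_bigr => i _ /=; rewrite mxE mulrCA mulrA.
Qed.

Lemma dotv_ge0 u : 0 <= dotv u u.
Proof. by apply: sumr_ge0 => i _; rewrite -expr2 sqr_ge0. Qed.

Lemma dotv_eq0 u : (dotv u u == 0) = (u == 0).
Proof.
apply/eqP/eqP => [|->]; last by apply: big1 => i _; rewrite mxE mul0r.
move/psumr_eq0P => h; apply/colP => i; rewrite mxE.
have /eqP := h (fun i _ => sqr_ge0 (u i 0)) i isT.
by rewrite mulf_eq0 orbb => /eqP.
Qed.

Lemma dotv_gt0 u : u != 0 -> 0 < dotv u u.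
Proof. by rewrite lt0r dotv_ge0 dotv_eq0 => ->. Qed.

Lemma l2norm_ge0 u : 0 <= l2norm u.
Proof. exact: sqrtr_ge0. Qed.

Lemma l2norm_sqr u : l2norm u ^+ 2 = dotv u u.
Proof. by rewrite sqr_sqrtr // sumr_ge0 // => i _; rewrite sqr_ge0. Qed.

Lemma l2norm_gt0 u : u != 0 -> 0 < l2norm u.
Proof.
by move=> /dotv_gt0; rewrite -l2norm_sqr exprn_even_gt0 //= lt0r l2norm_ge0 => ->.
Qed.

(* Cauchy-Schwarz for the semidefinite form of S, from the sign of the
   quadratic t |-> <u + t v, S (u + t v)>. *)
Lemma psd_cauchy_schwarz S u v : S^T = S -> (forall w, 0 <= dotv w (S *m w)) ->
  dotv u (S *m v) ^+ 2 <= dotv u (S *m u) * dotv v (S *m v).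
Proof.
move=> symS psdS.
set a := dotv u (S *m u); set b := dotv u (S *m v); set c := dotv v (S *m v).
have q t : 0 <= a + 2 * t * b + t ^+ 2 * c.
  have -> : a + 2 * t * b + t ^+ 2 * c = dotv (u + t *: v) (S *m (u + t *: v)).
    rewrite mulmxDr -scalemxAr !dotvDl !dotvDr !dotvZl !dotvZr.
    rewrite -/a -/b -/c (dotvC v) dotv_tr symS -/b; ring.
  exact: psdS.
have [c0|c0] := eqVneq c 0.
  have [->|b0] := eqVneq b 0; first by rewrite c0 mulr0 expr0n.
  (* For [c = 0] the quadratic is affine in [t]; this [t] would give it the value -1. *)
  have := q (- (a + 1) / (2 * b)).
  have -> : a + 2 * (- (a + 1) / (2 * b)) * b + (- (a + 1) / (2 * b)) ^+ 2 * c
     = -1 by rewrite c0; field.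
  lra.
have cp : 0 < c by rewrite lt0r c0 psdS.
(* The minimiser of the quadratic. *)
have := q (- b / c).
have -> : a + 2 * (- b / c) * b + (- b / c) ^+ 2 * c = (a * c - b ^+ 2) / c.
  by field.
by rewrite pmulr_lge0 ?invr_gt0 // subr_ge0.
Qed.

Lemma cauchy_schwarz u v : `|dotv u v| <= l2norm u * l2norm v.
Proof.
rewrite -ler_sqr ?nnegrE ?normr_ge0 ?mulr_ge0 ?l2norm_ge0 //.
rewrite real_normK ?num_real // exprMn !l2norm_sqr.
have := @psd_cauchy_schwarz 1%:M u v (tr_scalar_mx _ _).
by rewrite !mul1mx; apply => w; rewrite mul1mx dotv_ge0.
Qed.

Lemma l2normD u v : l2norm (u + v) <= l2norm u + l2norm v.
Proof.
rewrite -ler_sqr ?nnegrE ?addr_ge0 ?l2norm_ge0 //.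
rewrite sqrrD !l2norm_sqr dotvDl !dotvDr (dotvC v u).
have := le_trans (ler_norm _) (cauchy_schwarz u v); lra.
Qed.

Lemma l2normZ a u : l2norm (a *: u) = `|a| * l2norm u.
Proof.
apply/eqP; rewrite -(eqrXn2 (n := 2)) ?mulr_ge0 ?l2norm_ge0 //.
by rewrite exprMn real_normK ?num_real // !l2norm_sqr dotvZl dotvZr mulrA.
Qed.

Lemma l2normN u : l2norm (- u) = l2norm u.
Proof. by rewrite -scaleN1r l2normZ normrN1 mul1r. Qed.

Lemma l2norm_le_const u b : 0 <= b -> (forall i, `|u i 0| <= b) ->
  l2norm u <= Num.sqrt n%:R * b.
Proof.
move=> b0 ub; rewrite -ler_sqr ?nnegrE ?mulr_ge0 ?l2norm_ge0 ?sqrtr_ge0 //.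
rewrite exprMn l2norm_sqr sqr_sqrtr ?ler0n //.
have -> : n%:R * b ^+ 2 = \sum_(i < n) b ^+ 2.
  by rewrite sumr_const card_ord mulr_natl.
apply: ler_sum => i _; rewrite -expr2 -(real_normK (num_real _)).
by rewrite ler_sqr ?nnegrE ?normr_ge0.
Qed.

Lemma sum_mul_le_l2norm u (w : 'I_n -> R) b : 0 <= b ->
  (forall i, `|w i| <= b) ->
  `|\sum_i u i 0 * w i| <= Num.sqrt n%:R * l2norm u * b.
Proof.
move=> b0 wb.
have -> : \sum_i u i 0 * w i = dotv u (\col_i w i).
  by apply: eq_bigr => i _; rewrite mxE.
apply: le_trans (cauchy_schwarz _ _) _.
rewrite [_ * l2norm u]mulrC -mulrA ler_wpM2l ?l2norm_ge0 //.
by apply: l2norm_le_const => // i; rewrite mxE.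
Qed.

(** Row-wise Cauchy-Schwarz: [K] is the squared Frobenius norm, plus 1 to make it positive. *)
Lemma mulmx_bounded A :
  exists2 K, 0 < K & forall v, dotv (A *m v) (A *m v) <= K * dotv v v.
Proof.
exists (1 + \sum_i \sum_j A i j ^+ 2) => [|v].
  by rewrite ltr_wpDr // sumr_ge0 // => i _; rewrite sumr_ge0 // => j _;
     rewrite sqr_ge0.
rewrite mulrDl mul1r big_distrl /= ler_wpDl ?dotv_ge0 //.
apply: ler_sum => i _; rewrite !mxE -expr2.
have -> : \sum_j A i j * v j 0 = dotv (\col_j A i j) v.
  by apply: eq_bigr => j _; rewrite mxE.
have -> : \sum_j A i j ^+ 2 = dotv (\col_j A i j) (\col_j A i j).
  by apply: eq_bigr => j _; rewrite !mxE.
rewrite -!l2norm_sqr -exprMn -(real_normK (num_real _)).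
by rewrite ler_sqr ?nnegrE ?mulr_ge0 ?l2norm_ge0 // cauchy_schwarz.
Qed.

End DotProduct.

(** * Extreme eigenvalues and spectral norm through the Rayleigh quotient *)

Section Rayleigh.
Context {R : realType} {n : nat}.
Implicit Types (u v : 'cV[R]_n) (A S : 'M[R]_n).

(** [eigenvalue] speaks of row eigenvectors; transposition turns them into the columns used here. *)
Lemma eigenvalue_sym_colP S a : S^T = S ->
  reflect (exists2 v : 'cV[R]_n, S *m v = a *: v & v != 0) (eigenvalue S a).
Proof.
move=> symS; apply: (iffP eigenvalueP) => -[v hv v0].
  exists v^T; last by rewrite -trmx0 (inj_eq trmx_inj).
  by rewrite -{1}symS -trmx_mul hv linearZ.
exists v^T; last by rewrite -trmx0 (inj_eq trmx_inj).
by rewrite -{1}symS -trmx_mul hv linearZ.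
Qed.

Lemma eigenvalue_rayleigh S a : S^T = S -> eigenvalue S a ->
  exists2 v, v != 0 & dotv v (S *m v) = a * dotv v v.
Proof.
move=> symS /(eigenvalue_sym_colP _ symS)[v hv v0]; exists v => //.
by rewrite hv dotvZr.
Qed.

(* A positive semidefinite invertible matrix is bounded below: by
   Cauchy-Schwarz for its form, |S v|^4 <= K |S v|^2 <v, S v>. *)
Lemma psd_unit_coercive S : S^T = S -> (forall v, 0 <= dotv v (S *m v)) ->
  S \in unitmx -> exists2 e, 0 < e & forall v, e * dotv v v <= dotv v (S *m v).
Proof.
move=> symS psdS uS.
have [K K0 hK] := mulmx_bounded S.
have [L L0 hL] := mulmx_bounded (invmx S).
have LK0 : 0 < L * (1 + K) by rewrite mulr_gt0 // addr_gt0.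
(* The constant combines |v|^2 <= L |S v|^2 with |S v|^2 <= (1 + K) <v, S v>. *)
exists (L * (1 + K))^-1 => [|v]; first by rewrite invr_gt0.
rewrite mulrC ler_pdivrMr //.
have := hL (S *m v); rewrite mulKmx // => /le_trans; apply.
rewrite [leRHS]mulrC -mulrA ler_pM2l //.
set s := S *m v; set q := dotv v s.
have [->|s0] := eqVneq s 0.
  have /eqP -> : dotv (0 : 'cV[R]_n) 0 == 0 by rewrite dotv_eq0.
  by rewrite mulr_ge0 ?psdS // addr_ge0 // ltW.
rewrite -(ler_pM2l (dotv_gt0 s0)) mulrA -expr2.
apply: le_trans (psd_cauchy_schwarz s v symS psdS) _.
rewrite ler_wpM2r ?psdS //.
(* Expanding |s - S s|^2 >= 0 gives 2 <s, S s> <= (1 + K) |s|^2. *)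
have := dotv_ge0 (s - S *m s); have := hK s.
rewrite dotvDl !dotvDr !dotvNr !dotvNl (dotvC (S *m s) s).
have := dotv_ge0 s; nra.
Qed.

Lemma rayleigh_min S : (0 < n)%N -> S^T = S ->
  exists2 m, eigenvalue S m & forall v, m * dotv v v <= dotv v (S *m v).
Proof.
move=> n0 symS.
pose E := [set dotv v (S *m v) | v in [set v : 'cV[R]_n | dotv v v = 1]].
pose u v : 'cV[R]_n := (l2norm v)^-1 *: v.
have uE v : v != 0 -> dotv (u v) (u v) = 1.
  move=> v0; rewrite dotvZl dotvZr -l2norm_sqr; field.
  by rewrite gt_eqF ?l2norm_gt0.
have E0 : E !=set0.
  have v0 : const_mx 1 != 0 :> 'cV[R]_n.
    apply/eqP => /colP/(_ (Ordinal n0)); rewrite !mxE; exact/eqP/oner_neq0.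
  by exists (dotv (u (const_mx 1)) (S *m u (const_mx 1))), (u (const_mx 1));
     [exact: uE|].
have Einf : has_inf E.
  split=> //; have [K K0 hK] := mulmx_bounded S.
  (* |v + S v|^2 >= 0 with |v| = 1 bounds <v, S v> from below. *)
  exists (- (1 + K)) => _ [v /= v1 <-].
  have := dotv_ge0 (v + S *m v); have := hK v.
  rewrite dotvDl !dotvDr (dotvC (S *m v) v) v1; lra.
have ray v : inf E * dotv v v <= dotv v (S *m v).
  have [->|v0] := eqVneq v 0.
    have /eqP -> : dotv (0 : 'cV[R]_n) 0 == 0 by rewrite dotv_eq0.
    by rewrite mulmx0 mulr0; have := dotv_ge0 (0 : 'cV[R]_n).
  have : inf E <= dotv (u v) (S *m u v).
    by apply: ge_inf; [exact: Einf.2|exists (u v) => //; exact: uE].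
  rewrite -scalemxAr dotvZl dotvZr mulrA -expr2 exprVn l2norm_sqr mulrC.
  by rewrite ler_pdivlMr ?dotv_gt0.
exists (inf E) => //.
pose M := S - (inf E)%:M.
have dM v : dotv v (M *m v) = dotv v (S *m v) - inf E * dotv v v.
  by rewrite mulmxBl mul_scalar_mx dotvDr dotvNr dotvZr.
have symM : M^T = M by rewrite linearB /= symS tr_scalar_mx.
have psdM v : 0 <= dotv v (M *m v) by rewrite dM subr_ge0.
(* If [M] were invertible, coercivity would raise the lower bound of [E] to [inf E + e]. Otherwise
   its nonzero kernel is the eigenspace. *)
have [uM|] := boolP (M \in unitmx).
  have [e e0 he] := psd_unit_coercive symM psdM uM.
  suff : inf E + e <= inf E by rewrite gerDl leNgt e0.
  apply: lb_le_inf => // _ [v /= v1 <-].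
  by have := he v; rewrite dM v1; lra.
by rewrite -row_free_unit -kermx_eq0.
Qed.

(** The Rayleigh minimum is an eigenvalue and, tested on eigenvectors, lies below all others, so it
    is the infimum of the spectrum. *)
Lemma lambda_minP S : (0 < n)%N -> S^T = S ->
  eigenvalue S (lambda_min S) /\
  forall v, lambda_min S * dotv v v <= dotv v (S *m v).
Proof.
move=> n0 symS; have [m em hm] := rayleigh_min n0 symS.
suff -> : lambda_min S = m by [].
have lb a : eigenvalue S a -> m <= a.
  move=> /(eigenvalue_rayleigh symS)[v v0 hv]; have := hm v.
  by rewrite hv ler_pM2r ?dotv_gt0.
apply/eqP; rewrite eq_le; apply/andP; split.
  by apply: ge_inf => //; exists m.
by apply: lb_le_inf => //; exists m.
Qed.

(** Follows from [rayleigh_min] for [- S]: its minimum is the negative of an eigenvalue of [S]. *)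
Lemma lambda_max_ge S : (0 < n)%N -> S^T = S ->
  forall v, dotv v (S *m v) <= lambda_max S * dotv v v.
Proof.
move=> n0 symS v.
have symN : (- S)^T = - S by rewrite linearN /= symS.
have [m em hm] := rayleigh_min n0 symN.
have hm' w : dotv w (S *m w) <= - m * dotv w w.
  by have := hm w; rewrite mulNmx dotvNr; lra.
apply: le_trans (hm' v) _; rewrite ler_wpM2r ?dotv_ge0 //.
apply: ub_le_sup.
  exists (- m) => a /(eigenvalue_rayleigh symS)[w w0 hw]; have := hm' w.
  by rewrite hw ler_pM2r ?dotv_gt0.
apply/(eigenvalue_sym_colP _ symS).
have /(eigenvalue_sym_colP _ symN)[w hw w0] := em.
by exists w => //; rewrite scaleNr -hw mulNmx opprK.
Qed.

Lemma specnormP A v : (0 < n)%N -> l2norm (A *m v) <= specnorm A * l2norm v.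
Proof.
move=> n0; have symA : (A^T *m A)^T = A^T *m A by rewrite trmx_mul trmxK.
rewrite -ler_sqr ?nnegrE ?mulr_ge0 ?l2norm_ge0 ?sqrtr_ge0 //.
rewrite exprMn !l2norm_sqr dotv_tr mulmxA.
apply: le_trans (lambda_max_ge n0 symA v) _.
rewrite ler_wpM2r ?dotv_ge0 //.
(* Were [lambda_max] negative, it would still lie below the square on the right. *)
have [h|/ltW h] := leP 0 (lambda_max (A^T *m A)); first by rewrite sqr_sqrtr.
exact: le_trans h (sqr_ge0 _).
Qed.

Lemma specnorm_ge0 A : 0 <= specnorm A.
Proof. exact: sqrtr_ge0. Qed.

Lemma lambda_min_le_l2norm S v : (0 < n)%N -> S^T = S ->
  lambda_min S * l2norm v <= l2norm (S *m v).
Proof.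
move=> n0 symS; have [->|v0] := eqVneq v 0.
  by rewrite mulmx0 -(scale0r 0) l2normZ normr0 mul0r mulr0.
rewrite -(ler_pM2r (l2norm_gt0 v0)) -mulrA -expr2 l2norm_sqr.
apply: le_trans ((lambda_minP n0 symS).2 v) _.
by rewrite mulrC; apply: le_trans (ler_norm _) (cauchy_schwarz _ _).
Qed.

(** * Positive definite systems under perturbation *)

Section PositiveDefinite.
Variable S : 'M[R]_n.
Hypotheses (n0 : (0 < n)%N) (symS : S^T = S)
  (pdS : forall v, v != 0 -> 0 < dotv v (S *m v)).

Lemma lambda_min_gt0 : 0 < lambda_min S.
Proof.
have [v v0 hv] := eigenvalue_rayleigh symS (lambda_minP n0 symS).1.
by have := pdS v0; rewrite hv pmulr_lgt0 ?dotv_gt0.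
Qed.

Lemma lambda_min_le_specnorm : lambda_min S <= specnorm S.
Proof.
have /(eigenvalue_sym_colP _ symS)[v hv v0] := (lambda_minP n0 symS).1.
have := specnormP S v n0.
by rewrite hv l2normZ gtr0_norm ?lambda_min_gt0 // ler_pM2r ?l2norm_gt0.
Qed.

(** Test the inverse on [S *m v], with [v] an eigenvector for [lambda_min S]. *)
Lemma inv_lambda_min_le : (lambda_min S)^-1 <= specnorm (invmx S).
Proof.
have l0 := lambda_min_gt0.
have /(eigenvalue_sym_colP _ symS)[v hv v0] := (lambda_minP n0 symS).1.
(* [invmx] is a true inverse only on [unitmx]. A nonzero kernel row, transposed, would make the form
   vanish. *)
have uS : S \in unitmx.
  rewrite -unitmx_tr -row_free_unit -kermx_eq0; apply/eqP/row_matrixP => i.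
  rewrite row0 -[LHS]trmxK; apply/eqP; rewrite -trmx0 (inj_eq trmx_inj).
  apply/negPn/negP => /pdS.
  rewrite -[S in S *m _]trmxK -trmx_mul -row_mul mulmx_ker row0 trmx0.
  by rewrite /dotv big1 ?ltxx // => k _; rewrite !mxE mulr0.
have := specnormP (invmx S) (S *m v) n0.
rewrite mulKmx // hv l2normZ gtr0_norm // mulrA -{1}[l2norm v]mul1r.
by rewrite ler_pM2r ?l2norm_gt0 // -ler_pdivrMr // mul1r.
Qed.

Lemma specnorm_le_kappa : specnorm S <= kappa S * lambda_min S.
Proof.
rewrite -ler_pdivrMr ?lambda_min_gt0 // /kappa.
by rewrite ler_wpM2l ?specnorm_ge0 // inv_lambda_min_le.
Qed.

Lemma kappa_ge1 : 1 <= kappa S.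
Proof.
rewrite -(ler_pM2r lambda_min_gt0) mul1r.
exact: le_trans lambda_min_le_specnorm specnorm_le_kappa.
Qed.

Lemma solution_bound u v : S *m u = v -> lambda_min S * l2norm u <= l2norm v.
Proof. by move=> <-; exact: lambda_min_le_l2norm. Qed.

Variables (T : 'M[R]_n) (e r : R).
Hypotheses (e0 : 0 < e) (hT : specnorm (S - T) <= e * specnorm S)
  (hk : kappa S <= r / e).

(** The chain is e |S| <= e kappa(S) lambda_min(S) <= r lambda_min(S). *)
Lemma perturbation_le u : l2norm ((S - T) *m u) <= r * lambda_min S * l2norm u.
Proof.
apply: le_trans (specnormP _ _ n0) _; rewrite ler_wpM2r ?l2norm_ge0 //.
apply: le_trans hT _; rewrite mulrC -ler_pdivlMr //.
apply: le_trans specnorm_le_kappa _.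
by rewrite [leRHS]mulrAC ler_wpM2r // ltW ?lambda_min_gt0.
Qed.

(** The perturbation consumes at most the fraction [r] of the lower bound [lambda_min S]; this is
    the source of 1 - r in C. *)
Lemma perturbed_solution_bound u v : T *m u = v ->
  (1 - r) * lambda_min S * l2norm u <= l2norm v.
Proof.
move=> Tu; have := perturbation_le u; have := lambda_min_le_l2norm u n0 symS.
have -> : S *m u = v + (S - T) *m u by rewrite mulmxBl Tu addrC subrK.
by have := l2normD v ((S - T) *m u); lra.
Qed.

(* From T (u - u') = (v - v') - (S - T) u, where S u = v and T u' = v'. *)
Lemma solution_error_bound u v u' v' : S *m u = v -> T *m u' = v' ->
  (1 - r) * lambda_min S * l2norm (u - u') <=
  l2norm (v - v') + kappa S * (e * l2norm v).
Proof.
move=> Su Tu'.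
have /perturbed_solution_bound/le_trans :
    T *m (u - u') = (v - v') - (S - T) *m u.
  by rewrite mulmxBr mulmxBl Su Tu' opprB [RHS]addrC addrA subrK.
apply; apply: le_trans (l2normD _ _) _; rewrite lerD2l l2normN.
(* Unlike [perturbation_le], this keeps the factor [e], which the residual hypothesis absorbs
   later. *)
apply: le_trans (specnormP _ _ n0) _.
apply: le_trans (ler_wpM2r (l2norm_ge0 _) hT) _.
rewrite mulrCA -mulrA ler_pM2l //.
apply: le_trans (ler_wpM2r (l2norm_ge0 _) specnorm_le_kappa) _.
rewrite -mulrA ler_wpM2l ?solution_bound //.
by apply: le_trans ler01 kappa_ge1.
Qed.

End PositiveDefinite.
End Rayleigh.

(** * Weighted sums over chains *)

Section SumsOverChains.

(** Sequences are extended at the end because the recursion on chains peels off the largest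
    index. *)
Definition ffun_snoc (T : Type) m (i : {ffun 'I_m -> T}) (j : T) :
    {ffun 'I_m.+1 -> T} :=
  [ffun k => if unlift ord_max k is Some k' then i k' else j].

Lemma ffun_snoc_max (T : Type) m (i : {ffun 'I_m -> T}) j :
  ffun_snoc i j ord_max = j.
Proof. by rewrite ffunE unlift_none. Qed.

Lemma ffun_snoc_widen (T : Type) m (i : {ffun 'I_m -> T}) j k
    (h : (m <= m.+1)%N) :
  ffun_snoc i j (widen_ord h k) = i k.
Proof.
have -> : widen_ord h k = lift ord_max k.
  by apply/val_inj; rewrite /= /bump leqNgt ltn_ord.
by rewrite ffunE liftK.
Qed.

Lemma sum_ffun_snoc (R : nmodType) (T : finType) m
    (P : pred {ffun 'I_m.+1 -> T}) (h : {ffun 'I_m.+1 -> T} -> R) :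
  \sum_(f | P f) h f =
  \sum_j \sum_(i : {ffun 'I_m -> T} | P (ffun_snoc i j)) h (ffun_snoc i j).
Proof.
rewrite pair_big_dep /=.
pose init (f : {ffun 'I_m.+1 -> T}) : {ffun 'I_m -> T} :=
  [ffun k => f (widen_ord (leqnSn m) k)].
rewrite (reindex (fun p : T * {ffun 'I_m -> T} => ffun_snoc p.2 p.1)) //=.
exists (fun f : {ffun 'I_m.+1 -> T} => (f ord_max, init f)) => [[j i] _ | f _] /=.
  rewrite ffun_snoc_max; congr (_, _); apply/ffunP => k.
  by rewrite ffunE ffun_snoc_widen.
apply/ffunP => k; rewrite ffunE; case: unliftP => [k' ->|-> //].
rewrite ffunE; have -> // : widen_ord (leqnSn m) k' = lift ord_max k'.
by apply/val_inj; rewrite /= /bump leqNgt ltn_ord.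
Qed.

(** An element of S_J(m) without its forced last component J. *)
Definition chain J m (i : {ffun 'I_m -> 'I_J.+1}) : bool :=
  [forall k, (1 <= i k)%N] &&
  [forall k : 'I_m, forall l : 'I_m, (k < l)%N ==> (i k < i l)%N].

Lemma ord_max_case m (k : 'I_m.+1) :
  k = ord_max \/ exists k', k = widen_ord (leqnSn m) k'.
Proof.
have [/eqP h|h] := boolP (k == m :> nat); first by left; apply/val_inj.
right; have hk : (k < m)%N by rewrite ltn_neqAle h -ltnS ltn_ord.
by exists (Ordinal hk); apply/val_inj.
Qed.

Lemma chain_snoc J m (i : {ffun 'I_m.+1 -> 'I_J.+1}) j :
  chain (ffun_snoc i j) = chain i && (i ord_max < j)%N.
Proof.
apply/andP/andP => [[/forallP h1 /forallP h2]|[/andP[/forallP h1 /forallP h2] h3]].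
- split; last first.
    have /forallP/(_ ord_max) := h2 (widen_ord (leqnSn _) ord_max).
    by rewrite ffun_snoc_max ffun_snoc_widen /= ltnSn.
  apply/andP; split; apply/forallP => k.
    by have := h1 (widen_ord (leqnSn _) k); rewrite ffun_snoc_widen.
  apply/forallP => l.
  have /forallP/(_ (widen_ord (leqnSn _) l)) := h2 (widen_ord (leqnSn _) k).
  by rewrite !ffun_snoc_widen.
- have h4 k : (i k < j)%N.
    have [->//|[k' ek]] := ord_max_case k; apply: leq_ltn_trans h3; apply: ltnW.
    by have /forallP/(_ ord_max) := h2 k; rewrite ek /= ltn_ord.
  split; apply/forallP => k.
    have [->|[k' ->]] := ord_max_case k; last by rewrite ffun_snoc_widen.
    by rewrite ffun_snoc_max (leq_trans _ (h4 ord0)).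
  apply/forallP => l; apply/implyP.
  have [->|[k' ->]] := ord_max_case k.
    by rewrite ltnNge -ltnS ltn_ord.
  have [->|[l' ->]] := ord_max_case l.
    by rewrite ffun_snoc_max ffun_snoc_widen.
  by rewrite !ffun_snoc_widen; have /forallP/(_ l')/implyP := h2 k'.
Qed.

(** The last component must be J, and i_k <= J is carried by the type ['I_J.+1]. *)
Lemma index_set_snoc J M (i : {ffun 'I_M -> 'I_J.+1}) j : (0 < J)%N ->
  (ffun_snoc i j \in index_set J M) = chain i && (j == ord_max).
Proof.
move=> J0; rewrite inE ffun_snoc_max; apply/and4P/andP.
  case=> /forallP h1 /forallP h2 _ hj; split; last by [].
  apply/andP; split; apply/forallP => k.
    by have := h1 (widen_ord (leqnSn _) k); rewrite ffun_snoc_widen.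
  apply/forallP => l.
  have /forallP/(_ (widen_ord (leqnSn _) l)) := h2 (widen_ord (leqnSn _) k).
  by rewrite !ffun_snoc_widen /= ltn_ord andbT.
case=> /andP[/forallP h1 /forallP h2] /eqP ->; split => //.
- apply/forallP => k; have [->|[k' ->]] := ord_max_case k.
    by rewrite ffun_snoc_max.
  by rewrite ffun_snoc_widen.
- apply/forallP => k; apply/forallP => l; apply/implyP.
  have [->|[l' ->]] := ord_max_case l; first by rewrite ltnn andbF.
  have [->|[k' ->]] := ord_max_case k.
    by rewrite /= => /andP[/ltnW]; rewrite leqNgt ltn_ord.
  rewrite !ffun_snoc_widen /= => /andP[kl _].
  by have /forallP/(_ l')/implyP := h2 k'; apply.
- by apply/forallP => k; rewrite -ltnS ltn_ord.
Qed.

Context {R : realType}.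
Variables F c : nat -> R.

(* The sum over chains i_1 < ... < i_(M+1) = j of F i_1 * c i_1 * ... * c i_(M+1). *)
Fixpoint chain_weight M j : R :=
  if M is M'.+1 then c j * \sum_(1 <= k < j) chain_weight M' k else c j * F j.

(** Induction on the length: split off the last index [j], then group the shorter chains by their
    own last index [k < j]. *)
Lemma sum_chain J M (j : 'I_J.+1) : (0 < j)%N ->
  \sum_(i : {ffun 'I_M.+1 -> 'I_J.+1} | chain i && (i ord_max == j))
     F (i ord0) * \prod_k c (i k) = chain_weight M j.
Proof.
elim: M j => [|M IH] j j0.
  rewrite (big_pred1 [ffun => j]) => [|i].
    by rewrite big_ord1 !ffunE mulrC.
  apply/andP/eqP => [[_ /eqP h]|->]; last first.
    rewrite ffunE eqxx; split => //; apply/andP; split; apply/forallP => k.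
      by rewrite ffunE.
    by apply/forallP => l; rewrite !ord1.
  by apply/ffunP => k; rewrite ffunE -h; congr (i _); apply/val_inj; rewrite (ord1 k).
rewrite sum_ffun_snoc /= (bigD1 j) //= [X in _ + X]big1 ?addr0; last first.
  move=> j' jj'; apply: big_pred0 => i.
  by rewrite ffun_snoc_max (negPf jj') andbF.
transitivity (c j * \sum_(k : 'I_J.+1 | (0 < k < j)%N)
   \sum_(i : {ffun 'I_M.+1 -> 'I_J.+1} | chain i && (i ord_max == k))
     F (i ord0) * \prod_k c (i k)).
  rewrite big_distrr /=.
  under [RHS]eq_bigr do rewrite big_distrr /=.
  rewrite (partition_big (fun i : {ffun 'I_M.+1 -> 'I_J.+1} => i ord_max)
     (fun k : 'I_J.+1 => (0 < k < j)%N)) /=; last first.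
    move=> i; rewrite chain_snoc ffun_snoc_max eqxx andbT.
    by case/andP => /andP[/forallP h _] ->; rewrite h.
  apply: eq_bigr => k /andP[k0 kj]; apply: eq_big => i.
    rewrite chain_snoc ffun_snoc_max eqxx andbT.
    by case: eqP => [->|]; rewrite ?andbF // kj !andbT.
  move=> _; rewrite big_ord_recr /= ffun_snoc_max.
  have -> : ffun_snoc i j ord0 = i ord0.
    have -> : ord0 = widen_ord (leqnSn M.+1) ord0 by apply/val_inj.
    by rewrite ffun_snoc_widen.
  under eq_bigr do rewrite ffun_snoc_widen.
  by rewrite mulrA mulrC.
congr (_ * _).
rewrite (eq_bigr (fun k : 'I_J.+1 => chain_weight M k)); last first.
  by move=> k /andP[k0 _]; exact: IH.
rewrite (big_nat_widen _ _ J.+1); last exact: ltnW.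
by rewrite (big_nat_widenl _ 0) // big_mkord; apply: eq_bigl => k; rewrite andbC.
Qed.

(** Drop the final J and group the remaining chains by their last index. *)
Lemma sum_index_set J M : (0 < J)%N ->
  \sum_(i in index_set J M.+1) F (i (pos ord0)) * \prod_(k < M.+1) c (i (pos k))
  = \sum_(1 <= j < J.+1) chain_weight M j.
Proof.
move=> J0.
rewrite sum_ffun_snoc /= (bigD1 ord_max) //= [X in _ + X]big1 ?addr0; last first.
  move=> j jJ; apply: big_pred0 => i.
  by rewrite index_set_snoc // (negPf jJ) andbF.
rewrite (big_nat_widenl _ 0) // big_mkord.
transitivity (\sum_(j : 'I_J.+1 | (0 < j)%N)
   \sum_(i : {ffun 'I_M.+1 -> 'I_J.+1} | chain i && (i ord_max == j))
     F (i ord0) * \prod_k c (i k)); last first.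
  by apply: eq_bigr => j j0; exact: sum_chain.
rewrite (partition_big (fun i : {ffun 'I_M.+1 -> 'I_J.+1} => i ord_max)
     (fun k : 'I_J.+1 => (0 < k)%N)) /=; last first.
  by move=> i; rewrite index_set_snoc // => /andP[/andP[/forallP h _] _]; exact: h.
apply: eq_bigr => k k0; apply: eq_big => i.
  by rewrite index_set_snoc // eqxx andbT.
move=> _; rewrite ffun_snoc_widen.
by under eq_bigr do rewrite ffun_snoc_widen.
Qed.

Hypotheses (F0 : forall j, 0 <= F j).

(** This is T_j. A chain of positive integers ending at [j] has at most [j] terms, and [M] is the
    number of terms minus one. *)
Definition chain_total j : R := \sum_(0 <= M < j) chain_weight M j.

Lemma chain_weight_ge0 J M j : (forall j, (1 <= j <= J)%N -> 0 <= c j) ->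
  (1 <= j <= J)%N -> 0 <= chain_weight M j.
Proof.
move=> c0; elim: M j => [|M IH] j jJ /=; first by rewrite mulr_ge0 ?c0.
rewrite mulr_ge0 ?c0 // big_nat_cond sumr_ge0 // => k.
rewrite andbT => /andP[k0 kj]; apply: IH.
by case/andP: jJ => _; rewrite k0; apply: leq_trans; exact: ltnW.
Qed.

(** The recursion for T_j, as an inequality. [M = 0] yields [c j * F j]; in the other terms,
    exchanging the sums leaves for each [k] a sum that contains [chain_total k] plus nonnegative
    terms. *)
Lemma chain_total_ge J j : (forall j, (1 <= j <= J)%N -> 0 <= c j) ->
  (1 <= j <= J)%N ->
  c j * (F j + \sum_(1 <= k < j) chain_total k) <= chain_total j.
Proof.
move=> c0; case: j => // j jJ.
rewrite /chain_total [leRHS]big_nat_recl //= mulrDr lerD2l.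
rewrite -big_distrr /= ler_wpM2l ?c0 //.
rewrite exchange_big /= big_nat_cond [leRHS]big_nat_cond.
apply: ler_sum => k; rewrite andbT => /andP[k0 kj].
rewrite [leRHS](big_cat_nat _ (n := k)) //= lerDl big_nat_cond sumr_ge0 //.
move=> M _; apply: (chain_weight_ge0 (J := J)) => //.
by rewrite k0; case/andP: jJ => _; apply: leq_trans; exact: ltnW.
Qed.

Lemma sum_chain_total_le J : (forall j, (1 <= j <= J)%N -> 0 <= c j) ->
  \sum_(1 <= j < J.+1) chain_total j <=
  \sum_(0 <= M < J) \sum_(1 <= j < J.+1) chain_weight M j.
Proof.
move=> c0; rewrite [leRHS]exchange_big /= big_nat_cond [leRHS]big_nat_cond.
apply: ler_sum => j; rewrite andbT => /andP[j0 jJ].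
rewrite [leRHS](big_cat_nat _ (n := j)) //= lerDl big_nat_cond sumr_ge0 //.
by move=> M _; apply: (chain_weight_ge0 (J := J)) => //; rewrite j0.
Qed.

End SumsOverChains.

(** * Error propagation through a single stage *)

Section SingleStage.
Context {R : realType} {d : nat}.
Variables (Omega : set 'rV[R]_d) (Phi : 'rV[R]_d -> R).
Hypotheses (symPhi : symmetric_kernel Omega Phi)
  (pdPhi : positive_definite_kernel Omega Phi).

(** Positive definiteness at two distinct points with coefficients (1, 1) and (1, -1) gives Phi(0) +
    Phi(x - y) > 0 and Phi(0) - Phi(x - y) > 0. *)
Lemma kernel_bound x y : Omega x -> Omega y -> `|Phi (x - y)| <= Phi 0.
Proof.
move=> Ox Oy.
have [->|xy] := eqVneq x y.
  have := pdPhi (n := 1) (x := fun=> y) (a := const_mx 1).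
  rewrite !big_ord1 !mxE !mul1r subrr => h.
  rewrite ger0_norm // ltW // h // => [i j _|]; first by rewrite !ord1.
  by apply/eqP => /colP/(_ 0); rewrite !mxE => /eqP; rewrite oner_eq0.
have pd2 e : e != 0 -> 0 < (1 + e * e) * Phi 0 + 2 * e * Phi (x - y).
  move=> e0.
  have := pdPhi (n := 2) (x := fun i => if i == 0 then x else y)
    (a := \col_i (if i == 0 then 1 else e)).
  rewrite !big_ord_recl !big_ord0 !mxE /= !subrr -(symPhi Ox Oy) => h.
  rewrite (lt_le_trans (h _ _ _)) //.
  - move=> i j; case: (unliftP ord0 i) => [i'|] ->;
      case: (unliftP ord0 j) => [j'|] -> //=.
    + by rewrite !ord1.
    + by move=> /eqP; rewrite eq_sym (negPf xy).
    + by move=> /eqP; rewrite (negPf xy).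
  - by move=> i; case: ifP.
  - by apply/eqP => /colP/(_ 0); rewrite !mxE eqxx => /eqP; rewrite oner_eq0.
  - by rewrite le_eqVlt; apply/orP; left; apply/eqP; ring.
have := pd2 1 (oner_neq0 _); have := pd2 (-1); rewrite oppr_eq0 oner_neq0.
move=> /(_ isT) h1 h2; rewrite ler_norml; apply/andP; split; lra.
Qed.

Variable X : {fset 'rV[R]_d}.
Hypotheses (X0 : X <> fset0) (XOmega : forall x, x \in X -> Omega x).

Lemma card_gt0 : (0 < #|` X|)%N.
Proof. by rewrite cardfs_gt0; apply/eqP. Qed.

(* Unqualified, [point] is the base point of a pointed type. *)
Lemma point_in (u : 'I_#|` X|) : Omega (Defs.point u).
Proof. by apply: XOmega; apply/mem_nth/ltn_ord.
Qed.

Lemma point_inj : injective (@Defs.point R d X).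
Proof.
move=> u v /eqP; rewrite /Defs.point nth_uniq //= => [/eqP|]; last exact: fset_uniq.
exact: val_inj.
Qed.

Lemma kernel_mx_sym : (kernel_mx Phi X)^T = kernel_mx Phi X.
Proof. by apply/matrixP => u v; rewrite !mxE symPhi //; exact: point_in. Qed.

Lemma kernel_mx_pd v : v != 0 -> 0 < dotv v (kernel_mx Phi X *m v).
Proof.
move=> v0; have := pdPhi point_inj point_in v0; congr (_ < _).
apply: eq_bigr => i _; rewrite mxE big_distrr; apply: eq_bigr => l _ /=.
by rewrite mxE; ring.
Qed.

Lemma gfactor_ge0 D x : 0 <= D -> Omega x -> 0 <= gfactor D X Phi.
Proof.
move=> D0 Ox; have lam0 := lambda_min_gt0 card_gt0 kernel_mx_sym kernel_mx_pd.
have k1 := kappa_ge1 card_gt0 kernel_mx_sym kernel_mx_pd.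
have phi0 : 0 <= Phi 0 := le_trans (normr_ge0 _) (kernel_bound Ox Ox).
rewrite mulr_ge0 ?divr_ge0 ?ler0n ?(ltW lam0) // addr_ge0 // mulr_ge0 //.
exact: le_trans ler01 k1.
Qed.

Lemma restr_normE f : l2norm (restr f X) = Num.sqrt #|` X|%:R * scaled_norm f X.
Proof.
have s0 : 0 < Num.sqrt #|` X|%:R :> R by rewrite sqrtr_gt0 ltr0n card_gt0.
rewrite /scaled_norm l2normZ gtr0_norm ?invr_gt0 // mulrA divff ?mul1r //.
by rewrite gt_eqF.
Qed.

(** [h] and [ht] stand for the exact and computed residuals entering the stage, so [f - h] is the
    sum of the earlier stages. [p] bounds that sum, [delta * p] its error, and [e] is the delta_j of
    the stage. *)
Variables (f ft h ht : 'rV[R]_d -> R) (Phit : 'rV[R]_d -> R).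
Variables (a at_ : 'cV[R]_#|` X|) (At : 'M[R]_#|` X|).
Variables (e delta D r p : R).
Hypotheses (e0 : 0 < e) (delta0 : 0 < delta) (delta1 : delta <= 1) (D0 : 0 < D)
  (p0 : 0 <= p) (r1 : r < 1).
Hypothesis (ha : kernel_mx Phi X *m a = restr h X) (hat : At *m at_ = restr ht X).
Hypothesis (hA : specnorm (kernel_mx Phi X - At) <= e * specnorm (kernel_mx Phi X)).
Hypothesis (hkappa : kappa (kernel_mx Phi X) <= r / e).
Hypothesis (hPhi : forall x y, Omega x -> Omega y ->
  `|Phi (x - y) - Phit (x - y)| <= D * delta).
Hypothesis (hf : l2norm (restr f X - restr ft X) <= delta * l2norm (restr f X)).
Hypothesis (hres : e * scaled_norm h X <= delta * scaled_norm f X).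
Hypothesis (hp : forall x, Omega x -> `|f x - h x| <= p).
Hypothesis (hpt : forall x, Omega x ->
  `|(f x - h x) - (ft x - ht x)| <= delta * p).

Let s : R := Num.sqrt #|` X|%:R.
Let lam := lambda_min (kernel_mx Phi X).
Let kap := kappa (kernel_mx Phi X).
Let F := scaled_norm f X.

Let n0 := card_gt0.
Let lam0 : 0 < lam := lambda_min_gt0 n0 kernel_mx_sym kernel_mx_pd.
Let kap1 : 1 <= kap := kappa_ge1 n0 kernel_mx_sym kernel_mx_pd.
Let s_ge0 : 0 <= s := sqrtr_ge0 _.
Let s2 : s * s = #|` X|%:R.
Proof. by rewrite -expr2 sqr_sqrtr ?ler0n. Qed.

Let F_ge0 : 0 <= F. Proof. exact: l2norm_ge0. Qed.

Lemma exact_rhs_bound : l2norm (restr h X) <= s * (F + p).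
Proof.
have -> : restr h X = restr f X - restr (fun x => f x - h x) X.
  by apply/colP => u; rewrite !mxE; ring.
apply: le_trans (l2normD _ _) _; rewrite l2normN restr_normE mulrDr lerD2l.
by apply: l2norm_le_const => // u; rewrite mxE; exact: hp (point_in u).
Qed.

Lemma rhs_error_bound : l2norm (restr h X - restr ht X) <= s * (delta * (F + p)).
Proof.
have -> : restr h X - restr ht X = (restr f X - restr ft X) -
    restr (fun x => (f x - h x) - (ft x - ht x)) X.
  by apply/colP => u; rewrite !mxE; ring.
apply: le_trans (l2normD _ _) _; rewrite l2normN mulrDr mulrDr; apply: lerD.
  by rewrite mulrCA -restr_normE.
apply: l2norm_le_const => [|u]; first by rewrite mulr_ge0 // ltW.
by rewrite mxE; exact: hpt (point_in u).
Qed.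

(** A condition number is at least 1, so [r / e] is positive. *)
Let r0 : 0 < r.
Proof.
have : 0 < r / e by exact: lt_le_trans ltr01 (le_trans kap1 hkappa).
by rewrite pmulr_lgt0 ?invr_gt0.
Qed.

(** The direct estimate is n / lambda_min * (F + p) * Phi(0). It is relaxed to the constant of the
    error bound so that a single T_j serves both. *)
Lemma exact_stage_bound x : Omega x ->
  `|kernel_sum Phi a x| <= 2 / (1 - r) * gfactor D X Phi * (F + p).
Proof.
move=> Ox; have phi0 : 0 <= Phi 0 := le_trans (normr_ge0 _) (kernel_bound Ox Ox).
have lea : l2norm a <= s * (F + p) / lam.
  rewrite ler_pdivlMr // mulrC; apply: le_trans exact_rhs_bound.
  exact: solution_bound n0 kernel_mx_sym _ _ ha.
have Fp0 : 0 <= F + p by rewrite addr_ge0.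
apply: (@le_trans _ _ (s * l2norm a * Phi 0)).
  by apply: sum_mul_le_l2norm => // u; exact: kernel_bound Ox (point_in u).
apply: (@le_trans _ _ (s * (s * (F + p) / lam) * Phi 0)).
  by rewrite ler_wpM2r // ler_wpM2l.
have -> : s * (s * (F + p) / lam) * Phi 0 = #|` X|%:R / lam * (F + p) * Phi 0.
  by rewrite -s2; ring.
rewrite /gfactor -/lam -/kap.
have -> : 2 / (1 - r) * (#|` X|%:R / lam * (kap * Phi 0 + D)) * (F + p) =
  #|` X|%:R / lam * (F + p) * (2 / (1 - r) * (kap * Phi 0 + D)) by ring.
have C1 : 1 <= 2 / (1 - r) by rewrite ler_pdivlMr ?subr_gt0 //; have := r0; lra.
rewrite ler_wpM2l ?mulr_ge0 ?ler0n ?invr_ge0 ?(ltW lam0) //.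
apply: (@le_trans _ _ (1 * (kap * Phi 0 + D))).
  by rewrite mul1r -[leLHS]addr0 lerD ?ler_peMl ?(ltW D0).
apply: ler_wpM2r C1; apply: addr_ge0 (ltW D0); apply: mulr_ge0 phi0.
exact: le_trans ler01 kap1.
Qed.

(** Split the error into the coefficient error against [Phi] and the computed coefficients against
    [Phi - Phit]. *)
Lemma stage_error_bound x : Omega x ->
  `|kernel_sum Phi a x - kernel_sum Phit at_ x| <=
  delta * (2 / (1 - r) * gfactor D X Phi * (F + p)).
Proof.
move=> Ox; have phi0 : 0 <= Phi 0 := le_trans (normr_ge0 _) (kernel_bound Ox Ox).
have Fp0 : 0 <= F + p by rewrite addr_ge0.
have q0 : 0 < (1 - r) * lam by rewrite mulr_gt0 // subr_gt0.
have le_diff : l2norm (a - at_) <=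
    s * (delta * (F + p) + kap * (delta * F)) / ((1 - r) * lam).
  rewrite ler_pdivlMr // mulrC.
  apply: le_trans _ _; first exact:
    (solution_error_bound n0 kernel_mx_sym kernel_mx_pd e0 hA hkappa ha hat).
  rewrite mulrDr; apply: lerD rhs_error_bound _.
  rewrite restr_normE -/s.
  have -> : kap * (e * (s * scaled_norm h X)) = s * (kap * (e * scaled_norm h X)).
    by ring.
  apply: ler_wpM2l s_ge0 _ _ _; apply: ler_wpM2l hres.
  exact: le_trans ler01 kap1.
(* The computed right-hand side is at most the exact one plus its error; [delta <= 1] turns 1 +
   delta into the 2 of C. *)
have le_at : l2norm at_ <= s * (2 * (F + p)) / ((1 - r) * lam).
  rewrite ler_pdivlMr // mulrC.
  apply: le_trans _ _; first exact:
    (perturbed_solution_bound n0 kernel_mx_sym kernel_mx_pd e0 hA hkappa hat).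
  have -> : restr ht X = restr h X + - (restr h X - restr ht X).
    by rewrite opprB addrC subrK.
  apply: le_trans (l2normD _ _) _; rewrite l2normN.
  have := exact_rhs_bound; have := rhs_error_bound.
  have : s * (delta * (F + p)) <= s * (F + p).
    by rewrite ler_wpM2l // ler_piMl.
  lra.
have -> : kernel_sum Phi a x - kernel_sum Phit at_ x =
    \sum_u (a - at_) u 0 * Phi (x - Defs.point u) +
    \sum_u at_ u 0 * (Phi (x - Defs.point u) - Phit (x - Defs.point u)).
  rewrite -big_split -sumrB; apply: eq_bigr => u _ /=; rewrite !mxE; ring.
apply: le_trans (ler_normD _ _) _.
have h1 := sum_mul_le_l2norm (a - at_) phi0
  (fun u => kernel_bound Ox (point_in u)).
have Dd0 : 0 <= D * delta by rewrite mulr_ge0 // ltW.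
have h2 := sum_mul_le_l2norm at_ Dd0 (fun u => hPhi Ox (point_in u)).
apply: le_trans (lerD h1 h2) _.
have h3 := ler_wpM2r phi0 (ler_wpM2l s_ge0 le_diff).
have h4 := ler_wpM2r Dd0 (ler_wpM2l s_ge0 le_at).
apply: le_trans (lerD h3 h4) _.
rewrite /gfactor -/lam -/kap -s2.
rewrite -subr_ge0.
(* The [D] terms cancel exactly; the remaining slack is nonnegative because [kap >= 1]. *)
have -> : delta * (2 / (1 - r) * (s * s / lam * (kap * Phi 0 + D)) * (F + p)) -
  (s * (s * (delta * (F + p) + kap * (delta * F)) / ((1 - r) * lam)) * Phi 0 +
   s * (s * (2 * (F + p)) / ((1 - r) * lam)) * (D * delta)) =
  (s * s / ((1 - r) * lam) * delta * Phi 0) * ((kap - 1) * F + (2 * kap - 1) * p).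
  by field; rewrite (gt_eqF lam0) /= subr_eq0 gt_eqF.
apply: mulr_ge0.
  by rewrite !mulr_ge0 // ?invr_ge0 ltW.
by apply: addr_ge0; apply: mulr_ge0 => //; move: kap1; move: (kap) => k; lra.
Qed.

End SingleStage.

(** * Telescoping of the ratios and the final estimate *)

Lemma telescope_ratio (R : fieldType) M (u : nat -> R) :
  (forall k, (k < M)%N -> u k.+1 != 0) ->
  \prod_(k < M) (u k / u k.+1) * u M = u 0%N.
Proof.
elim: M => [|M IH] hu; first by rewrite big_ord0 mul1r.
by rewrite big_ord_recr /= mulrA divfK ?hu // IH // => k kM; apply: hu; exact: ltnW.
Qed.

(** Multiplied by F_J, the product of the ratios leaves F_(i_1), and C^(M+1) supplies one C to each
    g, giving the weights [c]. *)
Lemma sum_rho_gfactor (R : realType) d (f : 'rV[R]_d -> R) J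
    (X : nat -> {fset 'rV[R]_d}) (Phi : nat -> 'rV[R]_d -> R) (D C : R) M :
  (0 < J)%N ->
  (forall (i : {ffun 'I_M.+2 -> 'I_J.+1}) (k : 'I_M.+1), i \in index_set J M.+1 ->
     scaled_norm f (X (i (pos_succ k))) != 0) ->
  scaled_norm f (X J) * (C ^+ M.+1 *
    \sum_(i in index_set J M.+1) \prod_(k < M.+1)
       (rho f (X (i (pos k))) (X (i (pos_succ k))) *
        gfactor D (X (i (pos k))) (Phi (i (pos k))))) =
  \sum_(1 <= j < J.+1) chain_weight (fun j => scaled_norm f (X j))
     (fun j => C * gfactor D (X j) (Phi j)) M j.
Proof.
move=> J0 hrho; rewrite -sum_index_set // !big_distrr /=.
apply: eq_bigr => i iS.
rewrite big_split [X in _ = _ * X]big_split /= prodr_const card_ord.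
(* [inord] turns positions into natural numbers, as [telescope_ratio] expects. *)
pose u k := scaled_norm f (X (i (inord k))).
have iJ : i ord_max = J :> nat by move: iS; rewrite inE => /and4P[_ _ _ /eqP].
have posE (k : 'I_M.+1) : pos k = inord k.
  by apply/val_inj; rewrite /= inordK // ltnS ltnW.
have pos_succE (k : 'I_M.+1) : pos_succ k = inord k.+1.
  by apply/val_inj; rewrite /= /bump leq0n inordK // ltnS.
have := @telescope_ratio _ M.+1 u.
have -> : \prod_(k < M.+1) (u k / u k.+1) =
    \prod_(k < M.+1) rho f (X (i (pos k))) (X (i (pos_succ k))).
  by apply: eq_bigr => k _; rewrite posE pos_succE.
have -> : u M.+1 = scaled_norm f (X J).
  have -> : u M.+1 = scaled_norm f (X (i ord_max)); last by rewrite iJ.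
  rewrite /u; have -> // : inord M.+1 = ord_max :> 'I_M.+2.
  by apply/val_inj; rewrite /= inordK.
rewrite /u -(posE ord0) => tel; rewrite -tel => [|k kM]; first by ring.
by have := hrho i (Ordinal kM) iS; rewrite pos_succE.
Qed.

Theorem theorem4p2 (R : realType) (d : nat) (Omega : set 'rV[R]_d)
  (f : 'rV[R]_d -> R) (J : nat) (hJ : (1 <= J)%N)
  (X : nat -> {fset 'rV[R]_d})
  (hX0 : forall j, (1 <= j <= J)%N -> X j <> fset0)
  (hXOmega : forall j, (1 <= j <= J)%N -> forall x, x \in X j -> Omega x)
  (hXnested : forall j, (1 <= j < J)%N -> fsubset (X j) (X j.+1))
  (Phi : nat -> 'rV[R]_d -> R)
  (hsym : forall j, (1 <= j <= J)%N -> symmetric_kernel Omega (Phi j))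
  (hcont : forall j, (1 <= j <= J)%N -> continuous_kernel Omega (Phi j))
  (hpd : forall j, (1 <= j <= J)%N -> positive_definite_kernel Omega (Phi j))
  (alpha : forall j, 'cV[R]_(#|` X j|))
  (halpha : solves_stages J f Phi (fun j => kernel_mx (Phi j) (X j)) alpha)
  (ft : 'rV[R]_d -> R)
  (At : forall j, 'M[R]_(#|` X j|))
  (Phit : nat -> 'rV[R]_d -> R)
  (alphat : forall j, 'cV[R]_(#|` X j|))
  (halphat : solves_stages J ft Phit At alphat)
  (delta_ : nat -> R) (delta D r : R)
  (hdelta_ : forall j, (1 <= j <= J)%N -> 0 < delta_ j)
  (hdelta : 0 < delta)
  (hdelta1 : delta <= 1)
  (hD : 0 < D)
  (hA : forall j, (1 <= j <= J)%N ->
     specnorm (kernel_mx (Phi j) (X j) - At j)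
       <= delta_ j * specnorm (kernel_mx (Phi j) (X j)))
  (hf : forall j, (1 <= j <= J)%N ->
     l2norm (restr f (X j) - restr ft (X j)) <= delta * l2norm (restr f (X j)))
  (hkappa : forall j, (1 <= j <= J)%N ->
     kappa (kernel_mx (Phi j) (X j)) <= r / delta_ j)
  (hr : forall j, (1 <= j <= J)%N -> r / delta_ j < 1 / delta_ j)
  (hPhi : forall j, (1 <= j <= J)%N ->
     (ereal_sup [set (`|Phi j (p.1 - p.2) - Phit j (p.1 - p.2)|)%:E
                | p in Omega `*` Omega] < (D * delta)%:E)%E)
  (hres : forall j, (1 <= j <= J)%N ->
     delta_ j * scaled_norm (fun x => f x - \sum_(1 <= k < j) stage Phi alpha k x)
                            (X j)
       <= delta * scaled_norm f (X j))
  (hrho : forall (M : nat) (i : {ffun 'I_M.+1 -> 'I_J.+1}) (k : 'I_M),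
     (1 <= M <= J)%N -> i \in index_set J M ->
     scaled_norm f (X (i (pos_succ k))) != 0) :
  forall x, Omega x ->
    `| \sum_(1 <= j < J.+1) stage Phi alpha j x
       - \sum_(1 <= j < J.+1) stage Phit alphat j x |
    <= delta * scaled_norm f (X J) *
       (\sum_(1 <= M < J.+1) (2 / (1 - r)) ^+ M *
          \sum_(i in index_set J M) \prod_(k < M)
             (rho f (X (i (pos k))) (X (i (pos_succ k))) *
              gfactor D (X (i (pos k))) (Phi (i (pos k))))).

Proof.
move=> x0 Ox0.
have J1 : (1 <= J <= J)%N by rewrite hJ leqnn.
have r1 : r < 1 by have := hr _ J1; rewrite ltr_pM2r ?invr_gt0 ?hdelta_.
pose C := 2 / (1 - r).
pose F j := scaled_norm f (X j).
pose c j := C * gfactor D (X j) (Phi j).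
pose T := chain_total F c.
have F0 j : 0 <= F j by exact: l2norm_ge0.
have c0 j : (1 <= j <= J)%N -> 0 <= c j.
  move=> jJ; rewrite mulr_ge0 ?divr_ge0 ?subr_ge0 ?(ltW r1) //.
  by apply: (gfactor_ge0 (hsym _ jJ) (hpd _ jJ) (hX0 _ jJ) (hXOmega _ jJ) (ltW hD) Ox0).
have T0 j : (1 <= j <= J)%N -> 0 <= T j.
  move=> jJ; rewrite /T /chain_total sumr_ge0 // => M _.
  exact: chain_weight_ge0 c0 jJ.
(* Strong induction on both bounds together, over all of [Omega], since later stages sample the
   earlier ones at their own points. *)
have bounds j : (1 <= j <= J)%N -> forall x, Omega x ->
    `|stage Phi alpha j x| <= T j /\
    `|stage Phi alpha j x - stage Phit alphat j x| <= delta * T j.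
  elim/ltn_ind: j => -[//|j] IH jJ x Ox.
  pose p := \sum_(1 <= k < j.+1) T k.
  have kJ k : (1 <= k < j.+1)%N -> (1 <= k <= J)%N.
    by case/andP: jJ => _ jJ /andP[-> /ltnW kj]; exact: leq_trans jJ.
  have p0 : 0 <= p.
    rewrite /p big_nat_cond sumr_ge0 // => k; rewrite andbT => /kJ; exact: T0.
  have resE g (Q : nat -> 'rV[R]_d -> R) y : Q 0%N y = 0 ->
      g y - residual g Q j.+1 y = \sum_(1 <= k < j.+1) Q k y.
    by move=> Q0; rewrite opprB addrC subrK big_ltn // Q0 add0r.
  have hp y : Omega y -> `|f y - residual f (stage Phi alpha) j.+1 y| <= p.
    move=> Oy; rewrite resE //.
    apply: le_trans (ler_norm_sum _ _ _) _.
    rewrite /p big_nat_cond [leRHS]big_nat_cond; apply: ler_sum => k.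
    by rewrite andbT => kj; have [] := IH k (proj2 (andP kj)) (kJ k kj) y Oy.
  have hpt y : Omega y -> `|(f y - residual f (stage Phi alpha) j.+1 y) -
      (ft y - residual ft (stage Phit alphat) j.+1 y)| <= delta * p.
    move=> Oy; rewrite !resE // -sumrB.
    apply: le_trans (ler_norm_sum _ _ _) _; rewrite /p big_distrr /=.
    rewrite big_nat_cond [leRHS]big_nat_cond; apply: ler_sum => k.
    by rewrite andbT => kj; have [] := IH k (proj2 (andP kj)) (kJ k kj) y Oy.
  have hPhi' y z : Omega y -> Omega z ->
      `|Phi j.+1 (y - z) - Phit j.+1 (y - z)| <= D * delta.
    move=> Oy Oz; rewrite -lee_fin; apply: le_trans (ltW (hPhi _ jJ)).
    by apply: ereal_sup_ubound; exists (y, z).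
  (* [residual] sums from stage 0, which is zero, whereas [hres] sums from stage 1. *)
  have hres' : delta_ j.+1 * scaled_norm (residual f (stage Phi alpha) j.+1) (X j.+1)
      <= delta * scaled_norm f (X j.+1).
    apply: le_trans (hres _ jJ); rewrite le_eqVlt; apply/orP; left; apply/eqP.
    congr (_ * scaled_norm _ _); apply/funext => y.
    by rewrite /residual big_ltn //= add0r.
  have hT := chain_total_ge F0 c0 jJ; rewrite -/T -/p in hT.
  split; apply: le_trans.
  - exact: (exact_stage_bound (hsym _ jJ) (hpd _ jJ) (hX0 _ jJ) (hXOmega _ jJ)
      (hdelta_ _ jJ) hD p0 r1 (halpha _ jJ) (hkappa _ jJ) hp Ox).
  - exact: hT.
  - exact: (stage_error_bound (hsym _ jJ) (hpd _ jJ) (hX0 _ jJ) (hXOmega _ jJ)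
      (hdelta_ _ jJ) hdelta hdelta1 hD p0 r1 (halpha _ jJ) (halphat _ jJ) (hA _ jJ)
      (hkappa _ jJ) hPhi' (hf _ jJ) hres' hp hpt Ox).
  - by rewrite ler_pM2l.
rewrite -sumrB; apply: le_trans (ler_norm_sum _ _ _) _.
apply: (@le_trans _ _ (delta * \sum_(1 <= j < J.+1) T j)).
  rewrite big_distrr /= big_nat_cond [leRHS]big_nat_cond; apply: ler_sum => j.
  by rewrite andbT ltnS => jJ; have [] := bounds j jJ x0 Ox0.
rewrite -mulrA ler_pM2l //; apply: le_trans (sum_chain_total_le F0 c0) _.
(* The shift matches M + 1 chain indices with [chain_weight M]. *)
rewrite big_add1 /= big_distrr /= le_eqVlt; apply/orP; left; apply/eqP.
rewrite big_nat_cond [RHS]big_nat_cond; apply: eq_bigr => M.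
rewrite andbT => /andP[_ MJ]; rewrite sum_rho_gfactor // => i k iS.
exact: hrho.
Qed.
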